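(* Let $M$ and $N$ be arbitrary discrete measure spaces, i.e. sets with all subsets measurable and measures $\mu,\nu$ given by positive masses $\mu_i=\mu(\{i\})>0$ ($i\in M$), $\nu_j=\nu(\{j\})>0$ ($j\in N$). Let $t>0$, $1\le q<p\le\infty$, $\alpha=1/q-1/p$, $C(p,q)=(1-q/p)^{1/q}$. For $a:M\times N\to\mathbb R$ let $\|a\|$ be the $L^{p,\infty}(\mu)$ quasi-norm of $i\mapsto\big(\sum_{j\in N}|a(i,j)|^q\nu_j\big)^{1/q}$ (the norm of $\ell^{p,\infty}_M(\ell^q_N)$), $\|a\|^{\top}$ the $L^{p,\infty}(\nu)$ quasi-norm of $j\mapsto\big(\sum_{i\in M}|a(i,j)|^q\mu_i\big)^{1/q}$ (the norm of $\ell^{p,\infty}_N(\ell^q_M)$ applied to the transpose), and $$|||a|||_{p,q,t}=\sup_{E,F}\big(\mu(E)^{\alpha}\vee t^{-1}\nu(F)^{\alpha}\big)^{-1}\Big(\sum_{(i,j)\in E\times F}|a(i,j)|^q\mu_i\nu_j\Big)^{1/q},$$ the supremum over $E\subset M$, $F\subset N$ of positive finite measure. Let $K_{p,q,t}(a)=\inf\{\|b\|+t\|c\|^{\top}: a=b+c\}$. Then for every $a$, $$C(p,q)\,|||a|||_{p,q,t}\le K_{p,q,t}(a)\le 2\,|||a|||_{p,q,t}.$$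
   Context: For a nonnegative function $g$ on a measure space, $g^*(s)=\inf\{\lambda>0:\text{measure}\{g>\lambda\}\le s\}$ and $\|g\|_{L^{p,\infty}}=\sup_{s>0}s^{1/p}g^*(s)$ (the sup norm when $p=\infty$). $u\vee v=\max(u,v)$. *)

(* Defs.v *)
From HB Require Import structures.
From mathcomp Require Import all_boot all_order all_algebra.
From mathcomp Require Import all_classical all_reals all_analysis.
Set Implicit Arguments. Unset Strict Implicit. Unset Printing Implicit Defensive.
Import Order.TTheory GRing.Theory Num.Theory.
Local Open Scope classical_set_scope.
Local Open Scope ring_scope.

Section discrete.
Context {R : realType}.

Definition invp (p : \bar R) : R :=
  match p with r%:E => r^-1 | _ => 0 end.

Definition dmeas {T : choiceType} (w : T -> R) (E : set T) : \bar R :=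
  (\esum_(i in E) (w i)%:E)%E.

Definition drearr {T : choiceType} (w : T -> R) (g : T -> \bar R) (s : R)
  : \bar R :=
  ereal_inf [set (l%:E)%E | l in
     [set l : R | 0 < l /\ (dmeas w [set i | (l%:E < g i)%E] <= s%:E)%E]].

(* ||g||_{L^{p,oo}(w)} = sup_{s>0} s^{1/p} g^*(s); sup norm when p = +oo
   (sup of the empty family taken as 0, g being nonnegative). *)
Definition weaknorm {T : choiceType} (w : T -> R) (p : \bar R)
  (g : T -> \bar R) : \bar R :=
  match p with
  | +oo%E => ereal_sup ([set 0%E] `|` range g)
  | _ => ereal_sup [set (((s `^ invp p)%:E) * drearr w g s)%E | s in
                     [set s : R | 0 < s]]
  end.

Definition rownorm {M N : choiceType} (nu : N -> R) (q : R)
  (a : M -> N -> R) (i : M) : \bar R :=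
  ((\esum_(j in [set: N]) ((`|a i j| `^ q) * nu j)%:E) `^ q^-1)%E.

Definition mixnorm {M N : choiceType} (mu : M -> R) (nu : N -> R)
  (p : \bar R) (q : R) (a : M -> N -> R) : \bar R :=
  weaknorm mu p (rownorm nu q a).

Definition mixnormT {M N : choiceType} (mu : M -> R) (nu : N -> R)
  (p : \bar R) (q : R) (a : M -> N -> R) : \bar R :=
  mixnorm nu mu p q (fun j i => a i j).

(* |||a|||_{p,q,t}; sup over E, F of positive finite measure
   (sup of the empty family taken as 0). *)
Definition tripnorm {M N : choiceType} (mu : M -> R) (nu : N -> R)
  (p : \bar R) (q t : R) (a : M -> N -> R) : \bar R :=
  let alpha := q^-1 - invp p in
  ereal_sup ([set 0%E] `|`
    [set (((Num.max ((fine (dmeas mu EF.1)) `^ alpha)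
                    (t^-1 * (fine (dmeas nu EF.2)) `^ alpha))^-1)%:E *
          ((\esum_(x in EF.1 `*` EF.2)
              ((`|a x.1 x.2| `^ q) * mu x.1 * nu x.2)%:E) `^ q^-1))%E
     | EF in [set EF : set M * set N |
               (0 < dmeas mu EF.1 < +oo)%E /\ (0 < dmeas nu EF.2 < +oo)%E]]).

Definition Kfun {M N : choiceType} (mu : M -> R) (nu : N -> R)
  (p : \bar R) (q t : R) (a : M -> N -> R) : \bar R :=
  ereal_inf [set (mixnorm mu nu p q bc.1 + t%:E * mixnormT mu nu p q bc.2)%E
             | bc in [set bc : (M -> N -> R) * (M -> N -> R) |
                        forall i j, a i j = bc.1 i j + bc.2 i j]].

Definition Cpq (p : \bar R) (q : R) : R := (1 - q * invp p) `^ q^-1.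

End discrete.

(* Main.v *)
(** Write [k = 1 - q/p]. A weak-norm bound [||g||_{p,oo} <= B] says exactly that
    every finite nonempty [D] contains a point [i] with
    [g i <= B * mu(D)^(-1/p)].

    Lower bound: removing such a point from [D] again and again, and using the
    concavity of [x |-> x^k], gives
    [\sum_(i in D) g(i)^q mu_i <= B^q mu(D)^k / k]; apply this to the rows of [b]
    and to the columns of [c], and conclude by Minkowski's inequality on [E * F].

    Upper bound: on a finite block [E * F] with, say,
    [mu(E)^alpha >= t^-1 nu(F)^alpha], the definition of [|||a|||] and averaging
    give a row whose remaining part has norm at most [|||a||| mu(E)^(-1/p)].
    Put this row in [b] and delete it; otherwise do the same with a column and
    [c]. Since the remaining sets decrease, the resulting splitting
    [b = a 1_S], [c = a (1 - 1_S)] satisfies [||b|| <= |||a|||] and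
    [t ||c||^T <= |||a|||]. A limit along an ultrafilter handles infinite [M]
    and [N]. *)
Require Import Defs.
From HB Require Import structures.
From mathcomp Require Import all_boot all_order all_algebra finmap.
From mathcomp Require Import ring lra.
From mathcomp Require Import all_classical all_reals all_analysis.
Import Order.TTheory GRing.Theory Num.Theory.
Local Open Scope classical_set_scope.
Local Open Scope ring_scope.

(** * Finite weighted sums and the 0/1 splitting of a nonnegative matrix *)

Section finite_sums.
Context {R : realType}.

Lemma sumr_fset_sub (T : choiceType) (A B : {fset T}) (f : T -> R) :
  (forall i, 0 <= f i) -> (A `<=` B)%fset ->
  \sum_(i <- A) f i <= \sum_(i <- B) f i.
Proof.
move=> f0 AB; rewrite (big_fsetID _ (fun i => i \in A) B f) /=.
have -> : [fset x in B | x \in A]%fset = A.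
  apply/fsetP => x; rewrite !inE /=; case: (boolP (x \in A)) => [xA|].
    by rewrite (fsubsetP AB).
  by rewrite andbF.
by rewrite lerDl sumr_ge0.
Qed.

Lemma sumr_fset_gt0 (T : choiceType) (A : {fset T}) (f : T -> R) :
  (forall i, 0 < f i) -> A != fset0 -> 0 < \sum_(i <- A) f i.
Proof.
move=> f0 /fset0Pn[i iA]; rewrite (big_fsetD1 i iA) /=.
by rewrite ltr_pwDl// sumr_ge0// => k _; exact: ltW.
Qed.

(** Averaging: if [f] exceeded [c] on all of [A], the weighted sum of [f i - c] would be
    positive. *)
Lemma exists_le_of_sum_le (T : choiceType) (A : {fset T}) (f w : T -> R) c :
  A != fset0 -> \sum_(i <- A) f i * w i <= c * \sum_(i <- A) w i ->
  (forall i, 0 < w i) -> exists2 i, i \in A & f i <= c.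
Proof.
move=> A0 fc w0; apply: contrapT => /forall2NP nA.
have : 0 < \sum_(i <- A) (f i - c) * w i.
  have gtc i : i \in A -> c < f i.
    by move=> iA; have [//|/negP] := nA i; rewrite -ltNge.
  case/fset0Pn: A0 => i iA; rewrite (big_fsetD1 i iA) /=.
  rewrite ltr_pwDl// ?mulr_gt0 ?subr_gt0 ?gtc//.
  rewrite big_seq_cond sumr_ge0// => k; rewrite andbT !inE => /andP[_ kA].
  by rewrite mulr_ge0 ?subr_ge0// ltW// gtc.
under eq_bigr do rewrite mulrBl.
by rewrite sumrB -mulr_sumr subr_gt0 ltNge fc.
Qed.

(* Peel off one line at a time: if the maximum is attained by the row side, some
   row has average at most [phi] of the remaining mass, so it goes to the [S]
   part together with all its remaining entries; else the same with a column. *)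
Lemma peeling (M N : choiceType) (mu : M -> R) (nu : N -> R)
    (x : M -> N -> R) (phi psi : R -> R) :
  (forall i, 0 < mu i) -> (forall j, 0 < nu j) ->
  (forall r, 0 <= phi r) -> (forall r, 0 <= psi r) ->
  (forall r s, 0 < r -> r <= s -> phi s <= phi r) ->
  (forall r s, 0 < r -> r <= s -> psi s <= psi r) ->
  (forall (E : {fset M}) (F : {fset N}), E != fset0 -> F != fset0 ->
    \sum_(i <- E) \sum_(j <- F) x i j * mu i * nu j <=
    Num.max (phi (\sum_(i <- E) mu i) * \sum_(i <- E) mu i)
            (psi (\sum_(j <- F) nu j) * \sum_(j <- F) nu j)) ->
  forall (E : {fset M}) (F : {fset N}), exists S : M -> N -> bool,
    (forall D : {fset M}, D != fset0 -> (D `<=` E)%fset -> exists2 i, i \in D &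
      \sum_(j <- F) (S i j)%:R * x i j * nu j <= phi (\sum_(i <- D) mu i)) /\
    (forall D : {fset N}, D != fset0 -> (D `<=` F)%fset -> exists2 j, j \in D &
      \sum_(i <- E) (~~ S i j)%:R * x i j * mu i <= psi (\sum_(j <- D) nu j)).
Proof.
move=> mu0 nu0 phi0 psi0 phid psid H E F.
(* Each step deletes either a row or a column, so the induction runs on the total number of both. *)
have [n] := ubnP (#|` E| + #|` F|)%N; elim: n E F => // n IH E F.
rewrite ltnS => szEF.
have [->|E0] := eqVneq E fset0.
  exists (fun _ _ => false); split => D D0.
    by rewrite fsubset0 (negbTE D0).
  move=> _; case/fset0Pn: D0 => j jD; exists j => //.
  by rewrite big_seq_fset0.
have [->|F0] := eqVneq F fset0.
  exists (fun _ _ => true); split => D D0; last first.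
    by rewrite fsubset0 (negbTE D0).
  move=> _; case/fset0Pn: D0 => j jD; exists j => //.
  by rewrite big_seq_fset0.
have := H E F E0 F0; rewrite le_max => /orP[HE|HF].
- have [i0 i0E Hi0] : exists2 i, i \in E &
      \sum_(j <- F) x i j * nu j <= phi (\sum_(i <- E) mu i).
    apply: (@exists_le_of_sum_le _ _ _ mu) => //.
    apply: le_trans HE; apply: ler_sum => i _; rewrite mulr_suml.
    by apply: ler_sum => j _; rewrite mulrAC.
  have [|S [S1 S2]] := IH (E `\ i0)%fset F.
    by move: szEF; rewrite (cardfsD1 i0 E) i0E.
  (* The whole row [i0] goes to [S]. It serves as the point for every [D] containing [i0], because
     [phi] decreases and [D] has at most the mass of [E]; any other [D] lies in [E] without [i0]. *)
  exists (fun i j => (i == i0) || S i j); split => D D0 DE.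
    have [i0D|i0D] := boolP (i0 \in D).
      exists i0 => //; under eq_bigr do rewrite eqxx /= mul1r.
      apply: (le_trans Hi0); apply: phid; first exact: sumr_fset_gt0.
      by apply: sumr_fset_sub => // i; exact: ltW.
    have [|i iD Hi] := S1 D D0; first by rewrite fsubsetD1 DE i0D.
    exists i => //; apply: le_trans Hi; apply: ler_sum => j _.
    by have [ii0|//] := eqVneq i i0; rewrite ii0 (negbTE i0D) in iD.
  (* Row [i0] contributes nothing to the complementary part, so the column bounds survive its
     reinsertion. *)
  have [j jD Hj] := S2 D D0 DE.
  exists j => //; apply: le_trans Hj.
  rewrite (big_fsetD1 i0 i0E) /= eqxx /= !mul0r add0r.
  rewrite big_seq [leRHS]big_seq; apply: ler_sum => i.
  by rewrite !inE => /andP[/negbTE -> _].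
- have [j0 j0F Hj0] : exists2 j, j \in F &
      \sum_(i <- E) x i j * mu i <= psi (\sum_(j <- F) nu j).
    apply: (@exists_le_of_sum_le _ _ _ nu) => //.
    rewrite exchange_big /= in HF.
    apply: le_trans HF; apply: ler_sum => j _; rewrite mulr_suml.
    exact: ler_sum.
  have [|S [S1 S2]] := IH E (F `\ j0)%fset.
    by move: szEF; rewrite (cardfsD1 j0 F) j0F addnCA.
  exists (fun i j => (j != j0) && S i j); split => D D0 DF; last first.
    have [j0D|j0D] := boolP (j0 \in D).
      exists j0 => //; under eq_bigr do rewrite eqxx /= mul1r.
      apply: (le_trans Hj0); apply: psid; first exact: sumr_fset_gt0.
      by apply: sumr_fset_sub => // i; exact: ltW.
    have [|j jD Hj] := S2 D D0; first by rewrite fsubsetD1 DF j0D.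
    exists j => //; apply: le_trans Hj; apply: ler_sum => i _.
    by have [jj0|//] := eqVneq j j0; rewrite jj0 (negbTE j0D) in jD.
  have [i iD Hi] := S1 D D0 DF.
  exists i => //; apply: le_trans Hi.
  rewrite (big_fsetD1 j0 j0F) /= eqxx /= !mul0r add0r.
  rewrite big_seq [leRHS]big_seq; apply: ler_sum => j.
  by rewrite !inE => /andP[-> _].
Qed.

(** Filters are closed under finite intersections; hence a limit splitting coincides on any finite
    block with some finite-stage splitting. *)
Lemma finite_agreement (X : Type) (U : set_system X) (I : eqType)
    (P : I -> X -> bool) (Q : I -> bool) (s : seq I) :
  Filter U -> (forall i, U [set x | P i x = Q i]) ->
  U [set x | {in s, forall i, P i x = Q i}].
Proof.
move=> FU UP; elim: s => [|i s IH].
  by apply: filterS filterT => x _.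
apply: filterS2 (UP i) IH => x /= Pi Ps k; rewrite inE => /orP[/eqP->//|].
exact: Ps.
Qed.

(* The 0/1 splittings of finite blocks are glued along an ultrafilter containing
   the tails of the directed set of finite blocks. *)
Lemma splitting (M N : choiceType) (mu : M -> R) (nu : N -> R)
    (x : M -> N -> R) (phi psi : R -> R) :
  (forall i, 0 < mu i) -> (forall j, 0 < nu j) ->
  (forall i j, 0 <= x i j) ->
  (forall r, 0 <= phi r) -> (forall r, 0 <= psi r) ->
  (forall r s, 0 < r -> r <= s -> phi s <= phi r) ->
  (forall r s, 0 < r -> r <= s -> psi s <= psi r) ->
  (forall (E : {fset M}) (F : {fset N}), E != fset0 -> F != fset0 ->
    \sum_(i <- E) \sum_(j <- F) x i j * mu i * nu j <=
    Num.max (phi (\sum_(i <- E) mu i) * \sum_(i <- E) mu i)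
            (psi (\sum_(j <- F) nu j) * \sum_(j <- F) nu j)) ->
  exists S : M -> N -> bool,
    (forall (D : {fset M}) (F : {fset N}), D != fset0 -> exists2 i, i \in D &
      \sum_(j <- F) (S i j)%:R * x i j * nu j <= phi (\sum_(i <- D) mu i)) /\
    (forall (D : {fset N}) (E : {fset M}), D != fset0 -> exists2 j, j \in D &
      \sum_(i <- E) (~~ S i j)%:R * x i j * mu i <= psi (\sum_(j <- D) nu j)).
Proof.
move=> mu0 nu0 x0 phi0 psi0 phid psid H.
pose X := ({fset M} * {fset N})%type.
have /choice[T HT] : forall Y : X, exists S, _ :=
  fun Y => @peeling M N mu nu x phi psi mu0 nu0 phi0 psi0 phid psid H Y.1 Y.2.
pose tail (Y : X) : set X :=
  [set Z | (Y.1 `<=` Z.1)%fset && (Y.2 `<=` Z.2)%fset].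
have [U [UU tailU]] : exists U, UltraFilter U /\ filter_from setT tail `<=` U.
  apply: ultraFilterLemma; apply: filter_from_proper; last first.
    by move=> Y _; exists Y; rewrite /tail /= !fsubset_refl.
  apply: filter_from_filter; first by exists (fset0, fset0).
  move=> Y Z _ _; exists (Y.1 `|` Z.1, Y.2 `|` Z.2)%fset => // W.
  by rewrite /tail /= !fsubUset => /andP[/andP[-> ->] /andP[-> ->]].
have FU : Filter U by have [] := UU; exact: _.
(* The entrywise limit along [U]: for each entry, [U] contains either the stages that select it or
   the stages that do not. *)
pose S i j := `[< U [set Y | T Y i j] >].
have US (ij : M * N) : U [set Y | T Y ij.1 ij.2 = S ij.1 ij.2].
  rewrite /S; case: asboolP => [//|nU].
  have [//|] := in_ultra_setVsetC [set Y | T Y ij.1 ij.2] UU.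
  by apply: filterS => Y /= /negP/negbTE.
have agree (D : {fset M}) (F : {fset N}) : exists Y : X,
    [/\ (D `<=` Y.1)%fset, (F `<=` Y.2)%fset &
        forall i j, i \in D -> j \in F -> T Y i j = S i j].
  have UA := @finite_agreement X U _ _ _ [seq (i, j) | i <- D, j <- F] FU US.
  have Ut : U (tail (D, F)) by apply: tailU; exists (D, F).
  have [Y [/= YA /andP[DY FY]]] := filter_ex (filterI UA Ut).
  exists Y; split=> // i j iD jF; apply: (YA (i, j)).
  by apply/allpairsP; exists (i, j).
exists S; split => D F D0.
  have [Y [DY FY TS]] := agree D F.
  have [i iD Hi] := (HT Y).1 D D0 DY; exists i => //.
  apply: le_trans Hi.
  (* The stage [Y] controls the sum over the larger set [Y.2]; nonnegativity allows restriction to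
     [F], where [T Y] equals [S]. *)
  apply: (@le_trans _ _ (\sum_(j <- F) (T Y i j)%:R * x i j * nu j)); last first.
    by apply: sumr_fset_sub => // j; rewrite !mulr_ge0 ?ler0n// ltW.
  rewrite big_seq [leRHS]big_seq; apply: ler_sum => j jF.
  by rewrite TS.
have [Y [FY DY TS]] := agree F D.
have [j jD Hj] := (HT Y).2 D D0 DY; exists j => //.
apply: le_trans Hj.
apply: (@le_trans _ _ (\sum_(i <- F) (~~ T Y i j)%:R * x i j * mu i)); last first.
  by apply: sumr_fset_sub => // i; rewrite !mulr_ge0 ?ler0n// ltW.
rewrite big_seq [leRHS]big_seq; apply: ler_sum => i iF.
by rewrite TS.
Qed.

End finite_sums.

(** * Weak norms tested on finite sets *)

Section weak_norm.
Context {R : realType}.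

Lemma esum_le_fset (T : choiceType) (A : set T) (f : T -> R) (c : R) :
  (\esum_(i in A) (f i)%:E <= c%:E)%E <->
  (forall F : {fset T}, [set` F] `<=` A -> \sum_(i <- F) f i <= c).
Proof.
split=> [fc F FA|fc].
  rewrite -lee_fin; apply: le_trans fc; apply: esum_ge; exists [set` F].
    by split=> //; exact: finite_fset.
  by rewrite fsbig_finite ?set_fsetK ?sumEFin//; exact: finite_fset.
apply: ge_ereal_sup => _ [X [finX XA] <-].
rewrite fsbig_finite//= sumEFin lee_fin; apply: fc.
by rewrite fset_setK.
Qed.

Lemma dmeas_fset (T : choiceType) (w : T -> R) (D : {fset T}) :
  (forall i, 0 < w i) -> dmeas w [set` D] = (\sum_(i <- D) w i)%:E.
Proof.
move=> w0; rewrite /dmeas esum_fset; last 2 first.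
- exact: finite_fset.
- by move=> i _; rewrite lee_fin ltW.
by rewrite fsbig_finite ?set_fsetK ?sumEFin//; exact: finite_fset.
Qed.

Lemma poweR_inv_le (x : \bar R) (q c : R) : 0 < q -> 0 <= c -> (0 <= x)%E ->
  (x `^ q^-1 <= c%:E)%E <-> (x <= (c `^ q)%:E)%E.
Proof.
move=> q0 c0 x0; have qn0 : q != 0 by rewrite gt_eqF.
have powK (y : \bar R) : (0 <= y)%E -> ((y `^ q^-1) `^ q = y)%E.
  by move=> y0; rewrite -poweRrM mulVf// poweRe1.
split=> h.
  rewrite -(powK x x0) -poweR_EFin; apply: gt0_ler_poweR => //.
  - exact: ltW.
  - by rewrite in_itv /= poweR_ge0 leey.
  - by rewrite in_itv /= lee_fin c0 leey.
have -> : c%:E = ((c `^ q)%:E `^ q^-1)%E.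
  by rewrite poweR_EFin -powRrM divff// powRr1.
apply: gt0_ler_poweR => //.
- by rewrite invr_ge0 ltW.
- by rewrite in_itv /= x0 leey.
- by rewrite in_itv /= lee_fin powR_ge0 leey.
Qed.

Lemma rownorm_le (M N : choiceType) (nu : N -> R) (q c : R) (b : M -> N -> R) i :
  (forall j, 0 < nu j) -> 0 < q -> 0 <= c ->
  (rownorm nu q b i <= c%:E)%E <->
  (forall F : {fset N}, \sum_(j <- F) `|b i j| `^ q * nu j <= c `^ q).
Proof.
move=> nu0 q0 c0; rewrite /rownorm poweR_inv_le//; last first.
  by apply: esum_ge0 => j _; rewrite lee_fin mulr_ge0 ?powR_ge0// ltW.
rewrite esum_le_fset; split=> h F; first exact: h.
by move=> _; exact: h.
Qed.

(** Finiteness yields one real level for all points, even where [g] is infinite; this places a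
    finite set inside a single superlevel set. *)
Lemma uniform_gap (T : eqType) (s : seq T) (g : T -> \bar R) (c : R) :
  (forall i, i \in s -> (c%:E < g i)%E) ->
  exists2 l, c < l & forall i, i \in s -> (l%:E < g i)%E.
Proof.
elim: s => [|i s IH] h; first by exists (c + 1) => //; rewrite ltrDl.
have [k ks|l cl hl] := IH; first by apply: h; rewrite inE ks orbT.
have [l' cl' hl'] : exists2 l', c < l' & (l'%:E < g i)%E.
  have := h i (mem_head _ _); case: (g i) => [r| |//].
    rewrite lte_fin => cr; exists ((c + r) / 2); first by rewrite midf_lt.
    by rewrite lte_fin midf_lt.
  by exists (c + 1); rewrite ?ltrDl// ltry.
exists (Num.min l l'); first by rewrite lt_min cl.
move=> k; rewrite inE => /orP[/eqP->|ks].
  by apply: le_lt_trans hl'; rewrite lee_fin ge_min lexx orbT.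
by apply: le_lt_trans (hl k ks); rewrite lee_fin ge_min lexx.
Qed.

(* Testing the weak norm on finite sets only: this makes the bound a family of
   conditions each of which is preserved by pointwise limits. *)
Lemma weaknorm_le (T : choiceType) (w : T -> R) (p : \bar R) (B : R)
    (g : T -> \bar R) :
  (forall i, 0 < w i) -> (0 < p)%E -> 0 <= B ->
  (weaknorm w p g <= B%:E)%E <->
  (forall D : {fset T}, D != fset0 -> exists2 i, i \in D &
     (g i <= (B * (\sum_(i <- D) w i) `^ (- invp p))%:E)%E).
Proof.
move=> w0 p0 B0; case: p p0 => [r| |//] /=; last first.
  move=> _; rewrite oppr0; split=> [gB D /fset0Pn[i iD]|h].
    exists i => //; rewrite powRr0 mulr1; apply: le_trans gB.
    by apply: ereal_sup_ubound; right; exists i.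
  (* For p infinite the mass factor is 1, and testing on singletons recovers the supremum. *)
  apply: ge_ereal_sup => _ [->|[i _ <-]]; first by rewrite lee_fin.
  have [|k] := h [fset i]%fset; first by apply/fset0Pn; exists i; rewrite inE.
  by rewrite inE => /eqP ->; rewrite powRr0 mulr1.
rewrite lte_fin => r0; have ri0 : 0 < r^-1 by rewrite invr_gt0.
split=> [gB D D0|h].
  apply: contrapT => /forall2NP nD.
  set m := \sum_(i <- D) w i.
  have m0 : 0 < m by exact: sumr_fset_gt0.
  have [i iD|l ltl hl] := @uniform_gap _ D g (B * m `^ (- r^-1)).
    by rewrite ltNge; apply/negP; case: (nD i).
  have l0 : 0 < l by apply: le_lt_trans ltl; rewrite mulr_ge0 ?powR_ge0.
  have Bl : B / l < m `^ r^-1.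
    by rewrite ltr_pdivrMr// mulrC -ltr_pdivrMr ?powR_gt0// -powRN.
  (* With s = u^r < m, every superlevel set of height below [l] contains [D] and so has measure
     above s. Thus the rearrangement at s is at least [l], while u l > B contradicts the norm
     bound. *)
  pose u := (B / l + m `^ r^-1) / 2.
  have u0 : 0 < u.
    by rewrite /u divr_gt0// ltr_wpDl ?powR_gt0// divr_ge0// ltW.
  have uE : (u `^ r) `^ r^-1 = u by rewrite -powRrM divff ?gt_eqF// powRr1// ltW.
  have um : u `^ r < m.
    rewrite -[ltRHS](powRr1 (ltW m0)) -(mulVf (lt0r_neq0 r0)) powRrM.
    by apply: gt0_ltr_powR; rewrite ?nnegrE ?powR_ge0 ?(ltW u0)// midf_lt.
  have lu : (l%:E <= drearr w g (u `^ r))%E.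
    apply: le_ereal_inf_tmp => _ [k [k0 hk] <-]; rewrite lee_fin leNgt.
    apply/negP => kl; move: hk; apply/negP; rewrite -ltNge.
    apply: (@lt_le_trans _ _ m%:E); first by rewrite lte_fin.
    apply: esum_ge; exists [set` D].
      split; first exact: finite_fset.
      move=> i /= iD; apply: lt_trans (hl i iD).
      by rewrite lte_fin.
    by rewrite fsbig_finite ?set_fsetK ?sumEFin//; exact: finite_fset.
  have : (u%:E * l%:E <= B%:E)%E.
    apply: le_trans gB; apply: le_trans; last first.
      by apply: ereal_sup_ubound; exists (u `^ r) => //=; rewrite powR_gt0.
    by rewrite uE lee_pmul2l ?fin_numE// lte_fin.
  by rewrite -EFinM lee_fin -ler_pdivlMr// leNgt midf_lt.
apply: ge_ereal_sup => _ [s /= s0 <-].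
have ss0 : 0 < s `^ r^-1 by rewrite powR_gt0.
suff H : (drearr w g s <= (B * s `^ (- r^-1))%:E)%E.
  apply: (@le_trans _ _ ((s `^ r^-1)%:E * (B * s `^ (- r^-1))%:E)%E).
    by rewrite lee_pmul2l ?lte_fin.
  by rewrite -EFinM lee_fin powRN mulrCA divff ?mulr1// gt_eqF.
(* The slack [e] makes the test level strictly positive, as [drearr] demands even when [B] is 0. *)
apply/lee_addgt0Pr => e e0; rewrite -EFinD.
apply: ereal_inf_lbound; exists (B * s `^ (- r^-1) + e) => //; split.
  by rewrite ltr_wpDl// mulr_ge0 ?powR_ge0.
(* A superlevel set of measure above [s] would contain a finite [F] of mass above [s], and the good
   point of [F] would lie below the level. *)
apply/esum_le_fset => F hF; rewrite leNgt; apply/negP => sF.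
have F0 : F != fset0.
  by apply/eqP => F0; move: sF; rewrite F0 big_seq_fset0 ltNge ltW.
have [i iF] := h F F0; apply/negP; rewrite -ltNge.
apply: lt_trans (hF i iF); rewrite lte_fin ltr_pwDr// ler_wpM2l// !powRN.
have F1 := lt_trans s0 sF.
rewrite lef_pV2 ?posrE ?powR_gt0//.
by apply: ge0_ler_powR; rewrite ?nnegrE ltW.
Qed.

(** The row norm is itself a supremum over finite [F], so the row [i] must be chosen before [F]. *)
Lemma mixnorm_le (M N : choiceType) (mu : M -> R) (nu : N -> R) (p : \bar R)
    (q B : R) (b : M -> N -> R) :
  (forall i, 0 < mu i) -> (forall j, 0 < nu j) -> (0 < p)%E -> 0 < q ->
  0 <= B ->
  (mixnorm mu nu p q b <= B%:E)%E <->
  (forall D : {fset M}, D != fset0 -> exists2 i, i \in D &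
     forall F : {fset N}, \sum_(j <- F) `|b i j| `^ q * nu j <=
       B `^ q * (\sum_(i <- D) mu i) `^ (- (q * invp p))).
Proof.
move=> mu0 nu0 p0 q0 B0; rewrite /mixnorm weaknorm_le//.
have E (D : {fset M}) : (B * (\sum_(i <- D) mu i) `^ (- invp p)) `^ q =
    B `^ q * (\sum_(i <- D) mu i) `^ (- (q * invp p)).
  by rewrite powRM ?powR_ge0// -powRrM mulNr [invp p * q]mulrC.
have c0 (D : {fset M}) : 0 <= B * (\sum_(i <- D) mu i) `^ (- invp p).
  by rewrite mulr_ge0 ?powR_ge0.
split=> h D D0; have [i iD hi] := h D D0; exists i => //.
  by rewrite -E; apply/(rownorm_le _ _ nu q _ b i nu0 q0 (c0 D)).
by apply/(rownorm_le _ _ nu q _ b i nu0 q0 (c0 D)); rewrite E.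
Qed.

Lemma weaknorm_ge0 (T : choiceType) (w : T -> R) (p : \bar R)
    (g : T -> \bar R) :
  (0 < p)%E -> (0 <= weaknorm w p g)%E.
Proof.
case: p => [r| |//] /= _; last by apply: ereal_sup_ubound; left.
apply: le_ereal_sup_tmp; exists ((1 `^ r^-1)%:E * drearr w g 1)%E.
  by exists 1 => /=.
rewrite mule_ge0 ?lee_fin ?powR_ge0//.
by apply: le_ereal_inf_tmp => _ [l [l0 _] <-]; rewrite lee_fin ltW.
Qed.

End weak_norm.

(** * Bounding the triple norm by the norms of a decomposition *)

Section lower_bound.
Context {R : realType}.

(** The concave function x^k lies below its tangent at [m]. *)
Lemma powR_tangent (k m m' : R) : 0 < k <= 1 -> 0 <= m' -> 0 < m ->
  m' `^ k + k * m `^ (k - 1) * (m - m') <= m `^ k.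
Proof.
move=> /andP[k0 k1] m'0 m0.
have [->|kn1] := eqVneq k 1.
  by rewrite subrr powRr0 !mul1r !powRr1// ?(ltW m0)// addrC subrK.
have {kn1}k1 : 0 < 1 - k by rewrite subr_gt0 lt_neqAle kn1.
have r0 : 0 <= m' / m by rewrite divr_ge0// ltW.
(* Young's inequality for (m'/m)^k and 1, with exponents 1/k and 1/(1-k), gives (m'/m)^k <= k m'/m +
   1 - k. *)
have := @conjugate_powR R ((m' / m) `^ k) 1 k^-1 (1 - k)^-1 (powR_ge0 _ _) ler01.
rewrite !invr_gt0 => /(_ k0 k1); rewrite !invrK addrC subrK => /(_ erefl).
rewrite -powRrM divff ?gt_eqF// powRr1// powR1 mul1r mulr1 => h.
have E : m' `^ k = (m' / m) `^ k * m `^ k.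
  by rewrite -powRM ?(ltW m0)// divfK ?gt_eqF.
have E' : k * m `^ (k - 1) * (m - m') = k * (1 - m' / m) * m `^ k.
  rewrite powRB ?(gt_eqF m0) ?implybT// powRr1 ?(ltW m0)//.
  by field; rewrite gt_eqF.
rewrite E E' -mulrDl ler_piMl ?powR_ge0//.
by lra.
Qed.

(** Remove the good point of [D]: by the tangent inequality its contribution is at most c/k times
    the drop of mass^k, and these drops telescope. *)
Lemma weak_sum_le (T : choiceType) (w y : T -> R) (k c : R) :
  (forall i, 0 < w i) -> 0 < k <= 1 -> 0 <= c ->
  (forall D : {fset T}, D != fset0 -> exists2 i, i \in D &
     y i <= c * (\sum_(i <- D) w i) `^ (k - 1)) ->
  forall D : {fset T},
    \sum_(i <- D) y i * w i <= c * (\sum_(i <- D) w i) `^ k / k.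
Proof.
move=> w0 k01 c0 h D; have /andP[k0 k1] := k01.
have [n] := ubnP #|` D|; elim: n D => // n IH D; rewrite ltnS => szD.
have [->|D0] := eqVneq D fset0.
  by rewrite !big_seq_fset0 powR0 ?gt_eqF// mulr0 mul0r.
have [i iD hi] := h D D0.
have {}IH : \sum_(i <- (D `\ i)%fset) y i * w i <=
    c * (\sum_(i <- (D `\ i)%fset) w i) `^ k / k.
  by apply: IH; move: szD; rewrite (cardfsD1 i D) iD.
have wD : \sum_(i <- D) w i = w i + \sum_(i <- (D `\ i)%fset) w i.
  by rewrite (big_fsetD1 i iD).
have m0 : 0 < \sum_(i <- D) w i by exact: sumr_fset_gt0.
rewrite (big_fsetD1 i iD) /=.
set m' := \sum_(i <- (D `\ i)%fset) w i in IH wD *.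
set m := \sum_(i <- D) w i in hi wD m0 *.
have m'0 : 0 <= m' by apply: sumr_ge0 => j _; exact: ltW.
apply: (le_trans (lerD (ler_wpM2r (ltW (w0 i)) hi) IH)).
have wi : w i = m - m' by rewrite wD addrK.
have t := @powR_tangent k m m' k01 m'0 m0.
rewrite wi ler_pdivlMr// mulrDl divfK ?gt_eqF//.
apply: le_trans (ler_wpM2l c0 t).
by rewrite le_eqVlt; apply/orP; left; apply/eqP; ring.
Qed.

(** Convexity of x^q, applied pointwise to |b|/B and |c|/C with weights B/(B+C) and C/(B+C), then
    summed. *)
Lemma minkowski_sum (T : Type) (s : seq T) (w b c : T -> R) (q B C : R) :
  (forall i, 0 <= w i) -> 1 <= q -> 0 < B -> 0 < C ->
  \sum_(i <- s) `|b i| `^ q * w i <= B `^ q ->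
  \sum_(i <- s) `|c i| `^ q * w i <= C `^ q ->
  \sum_(i <- s) `|b i + c i| `^ q * w i <= (B + C) `^ q.
Proof.
move=> w0 q1 B0 C0 hb hc.
have BC0 : 0 < B + C by rewrite addr_gt0.
have q0 : 0 <= q by exact: le_trans q1.
have t0 : 0 <= B / (B + C) by rewrite divr_ge0 ?ltW.
have t1 : B / (B + C) <= 1 by rewrite ler_pdivrMr// mul1r lerDl ltW.
pose t := B / (B + C).
have pw i : `|b i + c i| `^ q <= (B + C) `^ q *
    (t * (`|b i| `^ q / B `^ q) + (1 - t) * (`|c i| `^ q / C `^ q)).
  have bB0 : 0 <= `|b i| / B by rewrite divr_ge0// ltW.
  have cC0 : 0 <= `|c i| / C by rewrite divr_ge0// ltW.
  have divX (x y : R) : 0 <= x -> 0 < y -> x `^ q / y `^ q = (x / y) `^ q.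
    move=> x0 y0; rewrite powRM// ?invr_ge0 ?ltW//.
    by rewrite -(powR_inv1 (ltW y0)) -powRrM mulN1r powRN.
  rewrite !divX//.
  have := @convex_powR R q q1 (Itv01 t0 t1) (`|b i| / B) (`|c i| / C).
  rewrite !inE /= !in_itv /= !andbT => /(_ bB0 cC0).
  rewrite !convRE /= /unstable.onem -/t => cv.
  apply: le_trans (ler_wpM2l (powR_ge0 _ _) cv).
  rewrite -powRM ?(ltW BC0)//; last first.
    by rewrite addr_ge0// mulr_ge0// subr_ge0.
  apply: ge0_ler_powR => //; rewrite ?nnegrE//.
    by rewrite mulr_ge0 ?(ltW BC0)// addr_ge0// mulr_ge0// subr_ge0.
  have -> : (B + C) * (t * (`|b i| / B) + (1 - t) * (`|c i| / C)) =
      `|b i| + `|c i|.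
    by rewrite /t; field; rewrite !gt_eqF.
  exact: ler_normD.
apply: (@le_trans _ _ (\sum_(i <- s) (B + C) `^ q *
    (t * (`|b i| `^ q * w i / B `^ q) + (1 - t) * (`|c i| `^ q * w i / C `^ q)))).
  apply: ler_sum => i _; apply: le_trans (ler_wpM2r (w0 i) (pw i)) _.
  by rewrite le_eqVlt; apply/orP; left; apply/eqP; ring.
rewrite -mulr_sumr big_split /= -!mulr_sumr -!mulr_suml.
rewrite ler_piMr ?powR_ge0//.
have tC : t * 1 + (1 - t) * 1 = 1 by ring.
rewrite -[leRHS]tC; apply: lerD; apply: ler_wpM2l => //; rewrite ?subr_ge0//.
  by rewrite ler_pdivrMr ?powR_gt0// mul1r.
by rewrite ler_pdivrMr ?powR_gt0// mul1r.
Qed.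

Lemma esum_block (M N : choiceType) (f : M -> N -> R) (D : {fset M})
    (F : {fset N}) : (forall i j, 0 <= f i j) ->
  (\esum_(x in [set` D] `*` [set` F]) (f x.1 x.2)%:E)%E =
  (\sum_(i <- D) \sum_(j <- F) f i j)%:E.
Proof.
move=> f0.
rewrite -[[set` D] `*` [set` F]]/([set` D] `*`` (fun=> [set` F])).
rewrite -(@esum_esum _ _ _ _ _ (fun i j => (f i j)%:E)); last first.
  by move=> i j _ _; rewrite lee_fin.
have sumE i : (\esum_(j in [set` F]) (f i j)%:E)%E = (\sum_(j <- F) f i j)%:E.
  rewrite esum_fset ?fsbig_finite ?set_fsetK ?sumEFin//;
    try exact: finite_fset.
  by move=> j _; rewrite lee_fin.
under eq_esum do rewrite sumE.
rewrite esum_fset ?fsbig_finite ?set_fsetK ?sumEFin//; try exact: finite_fset.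
by move=> i _; rewrite lee_fin sumr_ge0.
Qed.

Lemma sum_block (M N : choiceType) (f : M -> N -> R) (X : {fset M * N}) :
  (forall i j, 0 <= f i j) ->
  \sum_(x <- X) f x.1 x.2 <=
  \sum_(i <- [fset x.1 | x in X]%fset) \sum_(j <- [fset x.2 | x in X]%fset) f i j.
Proof.
move=> f0; rewrite -lee_fin -esum_block//; apply: esum_ge; exists [set` X].
  split; first exact: finite_fset.
  by move=> x /= xX; split=> /=; apply/imfsetP; exists x.
by rewrite fsbig_finite ?set_fsetK ?sumEFin//; exact: finite_fset.
Qed.

Lemma le_fine_dmeas (T : choiceType) (w : T -> R) (E : set T) (D : {fset T}) :
  (dmeas w E < +oo)%E -> (0 <= dmeas w E)%E -> [set` D] `<=` E ->
  \sum_(i <- D) w i <= fine (dmeas w E).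
Proof.
move=> Ey E0 DE; rewrite -lee_fin fineK ?ge0_fin_numE//.
apply: esum_ge; exists [set` D]; first by split=> //; exact: finite_fset.
by rewrite fsbig_finite ?set_fsetK ?sumEFin//; exact: finite_fset.
Qed.

Lemma invp_lt (p : \bar R) (q : R) : 1 <= q -> (q%:E < p)%E ->
  0 < 1 - q * invp p <= 1.
Proof.
move=> q1; have q0 : 0 < q by exact: lt_le_trans q1.
case: p => [r| |//]; last by rewrite /= mulr0 subr0 ltr01 lexx.
rewrite lte_fin => qr; have r0 : 0 < r by exact: lt_trans qr.
rewrite /= subr_gt0 ltr_pdivrMr// mul1r qr /= gerBl divr_ge0// ltW//.
Qed.

Lemma Cpq_gt0 (p : \bar R) (q : R) : 1 <= q -> (q%:E < p)%E -> 0 < Cpq p q.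
Proof. by move=> q1 qp; rewrite powR_gt0//; case/andP: (invp_lt p q q1 qp). Qed.

(** This is [weak_sum_le] with k = 1 - q/p; its factor 1/k is [Cpq p q] to the power -q. The bound
    [m] is kept apart from the mass of [D] because [D] will be only a finite part of a set of
    measure [m]. *)
Lemma mixnorm_block (M N : choiceType) (mu : M -> R) (nu : N -> R)
    (p : \bar R) (q B m : R) (b : M -> N -> R) (D : {fset M}) (F : {fset N}) :
  (forall i, 0 < mu i) -> (forall j, 0 < nu j) -> 1 <= q -> (q%:E < p)%E ->
  0 <= B -> (mixnorm mu nu p q b <= B%:E)%E -> \sum_(i <- D) mu i <= m ->
  \sum_(i <- D) \sum_(j <- F) `|b i j| `^ q * mu i * nu j <=
  (B * m `^ (q^-1 - invp p) / Cpq p q) `^ q.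
Proof.
move=> mu0 nu0 q1 qp B0 bB Dm; have q0 : 0 < q by exact: lt_le_trans q1.
have p0 : (0 < p)%E by apply: lt_trans qp; rewrite lte_fin.
have k01 := invp_lt p q q1 qp; have /andP[k0 k1] := k01.
set k := 1 - q * invp p in k01 k0 k1.
have D0 : 0 <= \sum_(i <- D) mu i by apply: sumr_ge0 => i _; exact: ltW.
have m0 : 0 <= m := le_trans D0 Dm.
have -> : (B * m `^ (q^-1 - invp p) / Cpq p q) `^ q = B `^ q * m `^ k / k.
  rewrite /Cpq -/k -powRN powRM ?mulr_ge0 ?powR_ge0// powRM ?powR_ge0//.
  rewrite -!powRrM mulNr mulVf ?gt_eqF// powR_inv1 ?ltW//.
  by rewrite mulrBl mulVf ?gt_eqF// [invp p * q]mulrC.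
have [h _] := mixnorm_le _ _ mu nu p q B b mu0 nu0 p0 q0 B0.
apply: (@le_trans _ _ (B `^ q * (\sum_(i <- D) mu i) `^ k / k)); last first.
  rewrite ler_pM2r ?invr_gt0// ler_wpM2l ?powR_ge0//.
  by apply: ge0_ler_powR; rewrite ?nnegrE// ltW.
have -> : \sum_(i <- D) \sum_(j <- F) `|b i j| `^ q * mu i * nu j =
    \sum_(i <- D) (\sum_(j <- F) `|b i j| `^ q * nu j) * mu i.
  apply: eq_bigr => i _; rewrite mulr_suml.
  by apply: eq_bigr => j _; rewrite mulrAC.
apply: weak_sum_le => // [|{Dm D0}D D0]; first exact: powR_ge0.
have [i iD hi] := h bB D D0; exists i => //.
by rewrite /k addrAC subrr add0r.
Qed.

(** Row bounds for [b] and column bounds for [c] are added by Minkowski; [B] and [C] are strictly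
    positive because that argument divides by them. *)
Lemma tripnorm_le (M N : choiceType) (mu : M -> R) (nu : N -> R)
    (p : \bar R) (q t B C : R) (b c : M -> N -> R) :
  (forall i, 0 < mu i) -> (forall j, 0 < nu j) -> 0 < t -> 1 <= q ->
  (q%:E < p)%E -> 0 < B -> 0 < C ->
  (mixnorm mu nu p q b <= B%:E)%E -> (mixnormT mu nu p q c <= C%:E)%E ->
  (tripnorm mu nu p q t (fun i j => (b i j + c i j)%R)
    <= ((B + t * C) / Cpq p q)%:E)%E.
Proof.
move=> mu0 nu0 t0 q1 qp B0 C0 bB cC; have q0 : 0 < q by exact: lt_le_trans q1.
have K0 := Cpq_gt0 p q q1 qp; set K := Cpq p q in K0 *.
have S0 : 0 < B + t * C by rewrite addr_gt0// mulr_gt0.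
apply: ge_ereal_sup => _ [->|[[E F] /= [/andP[E0 Ey] /andP[F0 Fy]] <-]].
  by rewrite lee_fin divr_ge0 ?ltW.
set al := q^-1 - invp p; set m := fine (dmeas mu E); set n := fine (dmeas nu F).
have m0 : 0 < m by rewrite fine_gt0// E0 Ey.
have n0 : 0 < n by rewrite fine_gt0// F0 Fy.
set L := Num.max _ _.
have L0 : 0 < L by rewrite lt_max powR_gt0.
have mL : m `^ al <= L by rewrite le_max lexx.
have nL : n `^ al <= t * L by rewrite -ler_pdivrMl// le_max lexx orbT.
suff H : ((\esum_(x in E `*` F)
    (`|b x.1 x.2 + c x.1 x.2| `^ q * mu x.1 * nu x.2)%:E) `^ q^-1
    <= (L * ((B + t * C) / K))%:E)%E.
  apply: le_trans (lee_wpmul2l _ H) _; first by rewrite lee_fin invr_ge0 ltW.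
  by rewrite -EFinM lee_fin mulKf ?gt_eqF.
apply/poweR_inv_le => //.
- by rewrite mulr_ge0 ?divr_ge0 ?ltW.
- by apply: esum_ge0 => x _; rewrite lee_fin !mulr_ge0 ?powR_ge0 ?ltW.
apply/esum_le_fset => X XEF.
(* The projections of [X] are finite parts of [E] and [F], and [X] lies in their product. *)
set D := [fset x.1 | x in X]%fset; set G := [fset x.2 | x in X]%fset.
have Dm : \sum_(i <- D) mu i <= m.
  apply: le_fine_dmeas => //; first exact: ltW.
  by move=> _ /= /imfsetP[x /= xX ->]; case: (XEF x xX).
have Gn : \sum_(j <- G) nu j <= n.
  apply: le_fine_dmeas => //; first exact: ltW.
  by move=> _ /= /imfsetP[x /= xX ->]; case: (XEF x xX).
have hb : \sum_(x <- X) `|b x.1 x.2| `^ q * (mu x.1 * nu x.2) <=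
    (B * m `^ al / K) `^ q.
  under eq_bigr do rewrite mulrA.
  apply: le_trans (sum_block _ _ (fun i j => `|b i j| `^ q * mu i * nu j) X _) _.
    by move=> i j; rewrite !mulr_ge0 ?powR_ge0 ?ltW.
  by apply: mixnorm_block => //; exact: ltW.
have hc : \sum_(x <- X) `|c x.1 x.2| `^ q * (mu x.1 * nu x.2) <=
    (C * n `^ al / K) `^ q.
  under eq_bigr do rewrite mulrA.
  apply: le_trans (sum_block _ _ (fun i j => `|c i j| `^ q * mu i * nu j) X _) _.
    by move=> i j; rewrite !mulr_ge0 ?powR_ge0 ?ltW.
  (* Exchanging the sums turns the column estimate into the row estimate for the transpose. *)
  rewrite exchange_big /=; under eq_bigr do under eq_bigr do rewrite mulrAC.
  exact: (@mixnorm_block _ _ nu mu p q C n (fun j i => c i j)) (ltW C0) cC Gn.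
under eq_bigr do rewrite -mulrA.
apply: le_trans (@minkowski_sum _ X (fun x => mu x.1 * nu x.2)
  (fun x => b x.1 x.2) (fun x => c x.1 x.2) q _ _ _ q1 _ _ hb hc) _.
- by move=> x; rewrite mulr_ge0 ?ltW.
- by rewrite divr_gt0// mulr_gt0// powR_gt0.
- by rewrite divr_gt0// mulr_gt0// powR_gt0.
have bL : B * m `^ al <= B * L by rewrite ler_pM2l.
have cL : C * n `^ al <= C * (t * L) by rewrite ler_pM2l.
apply: ge0_ler_powR; rewrite ?nnegrE ?(ltW q0)//.
- by rewrite addr_ge0 ?divr_ge0 ?mulr_ge0 ?powR_ge0 ?ltW.
- by rewrite mulr_ge0 ?divr_ge0 ?ltW.
rewrite -mulrDl mulrA ler_pM2r ?invr_gt0//.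
apply: (le_trans (lerD bL cL)).
by rewrite le_eqVlt; apply/orP; left; apply/eqP; ring.
Qed.

End lower_bound.

(** * From the triple norm to a decomposition *)

Section upper_bound.
Context {R : realType}.

(** [splitting] provides a row depending on [F], whereas [mixnorm_le] needs one row for all [F]. If
    each [i] in [D] failed on some [G i], the finite union of the [G i] would defeat every row at
    once. *)
Lemma exists_uniform (M N : choiceType) (D : {fset M}) (y : M -> N -> R) (c : R) :
  (forall i j, 0 <= y i j) ->
  (forall F : {fset N}, exists2 i, i \in D & \sum_(j <- F) y i j <= c) ->
  exists2 i, i \in D & forall F : {fset N}, \sum_(j <- F) y i j <= c.
Proof.
move=> y0 h; apply: contrapT => /forall2NP nD.
have /choice[G hG] : forall i, exists F : {fset N}, i \in D -> c < \sum_(j <- F) y i j.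
  move=> i; have [iD|/existsNP[F /negP]] := nD i; first by exists fset0 => /iD.
  by rewrite -ltNge => hF; exists F.
have [i iD] := h (\bigcup_(i <- D) G i)%fset.
apply/negP; rewrite -ltNge; apply: lt_le_trans (hG i iD) _.
apply: sumr_fset_sub => //; exact: bigfcup_sup.
Qed.

Lemma tripnorm_block (M N : choiceType) (mu : M -> R) (nu : N -> R)
    (p : \bar R) (q t A : R) (a : M -> N -> R) (E : {fset M}) (F : {fset N}) :
  (forall i, 0 < mu i) -> (forall j, 0 < nu j) -> 0 < t -> 0 < q -> 0 <= A ->
  (tripnorm mu nu p q t a <= A%:E)%E -> E != fset0 -> F != fset0 ->
  \sum_(i <- E) \sum_(j <- F) `|a i j| `^ q * mu i * nu j <=
  Num.max (A `^ q * (\sum_(i <- E) mu i) `^ (1 - q * invp p))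
          ((A / t) `^ q * (\sum_(j <- F) nu j) `^ (1 - q * invp p)).
Proof.
move=> mu0 nu0 t0 q0 A0 aA E0 F0.
set m := \sum_(i <- E) mu i; set n := \sum_(j <- F) nu j.
have m0 : 0 < m by exact: sumr_fset_gt0.
have n0 : 0 < n by exact: sumr_fset_gt0.
have ga0 i j : 0 <= `|a i j| `^ q * mu i * nu j.
  by rewrite !mulr_ge0 ?powR_ge0 ?ltW.
set al := q^-1 - invp p; set L := Num.max (m `^ al) (t^-1 * n `^ al).
have L0 : 0 < L by rewrite lt_max powR_gt0.
have powE (c r : R) : 0 <= c -> 0 < r ->
    (c * r `^ al) `^ q = c `^ q * r `^ (1 - q * invp p).
  move=> c0 r0; rewrite powRM ?powR_ge0// -powRrM mulrBl mulVf ?gt_eqF//.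
  by rewrite [invp p * q]mulrC.
apply: (@le_trans _ _ ((A * L) `^ q)).
  rewrite -lee_fin -(esum_block _ _ (fun i j => `|a i j| `^ q * mu i * nu j))//.
  apply/poweR_inv_le => //; first by rewrite mulr_ge0// ltW.
    by apply: esum_ge0 => x _; rewrite lee_fin.
  (* Inserting L/L exhibits the quotient whose supremum is the triple norm. *)
  rewrite mulrC EFinM -[X in (X <= _)%E]mul1e -(divff (lt0r_neq0 L0)) EFinM -muleA.
  rewrite lee_pmul2l ?lte_fin//; apply: le_trans aA.
  apply: ereal_sup_ubound; right; exists ([set` E], [set` F]) => /=.
    by rewrite !dmeas_fset// !lte_fin m0 n0 !ltry.
  by rewrite !dmeas_fset.
rewrite /L; case: (leP (m `^ al)) => _.
  by rewrite mulrA powE ?divr_ge0 ?(ltW t0)// le_max lexx orbT.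
by rewrite powE// le_max lexx.
Qed.

Lemma exists_splitting (M N : choiceType) (mu : M -> R) (nu : N -> R)
    (p : \bar R) (q t A : R) (a : M -> N -> R) :
  (forall i, 0 < mu i) -> (forall j, 0 < nu j) -> 0 < t -> 1 <= q ->
  (q%:E < p)%E -> 0 <= A -> (tripnorm mu nu p q t a <= A%:E)%E ->
  exists S : M -> N -> bool,
    (mixnorm mu nu p q (fun i j => ((S i j)%:R * a i j)%R) <= A%:E)%E /\
    (mixnormT mu nu p q (fun i j => ((~~ S i j)%:R * a i j)%R) <= (A / t)%:E)%E.
Proof.
move=> mu0 nu0 t0 q1 qp A0 aA; have q0 : 0 < q by exact: lt_le_trans q1.
have p0 : (0 < p)%E by apply: lt_trans qp; rewrite lte_fin.
have qi0 : 0 <= q * invp p.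
  rewrite mulr_ge0 ?(ltW q0)//; case: p p0 {qp aA} => [r| |//] //=.
  by rewrite lte_fin => r0; rewrite invr_ge0 ltW.
have At0 : 0 <= A / t by rewrite divr_ge0// ltW.
pose phi (c r : R) := c `^ q * r `^ (- (q * invp p)).
have phi0 c r : 0 <= phi c r by rewrite mulr_ge0 ?powR_ge0.
have phid c r s : 0 < r -> r <= s -> phi c s <= phi c r.
  move=> r0 rs; rewrite ler_wpM2l ?powR_ge0// !powRN.
  have s0 := lt_le_trans r0 rs.
  rewrite lef_pV2 ?posrE ?powR_gt0//.
  by apply: ge0_ler_powR; rewrite ?nnegrE// ltW.
have [|E F E0 F0|S [S1 S2]] := @splitting R M N mu nu (fun i j => `|a i j| `^ q)
  (phi A) (phi (A / t)) mu0 nu0 _ (phi0 _) (phi0 _) (phid _) (phid _).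
- by move=> i j; exact: powR_ge0.
(* Multiplying [phi] by the mass raises the exponent to 1 - q/p, so the block estimate becomes the
   averaging hypothesis of [splitting]. *)
- have phiM c r : 0 < r -> phi c r * r = c `^ q * r `^ (1 - q * invp p).
    move=> r0; rewrite /phi -mulrA; congr (_ * _).
    rewrite -{2}(powRr1 (ltW r0)) -powRD ?(gt_eqF r0) ?implybT//.
    by rewrite addrC.
  by rewrite !phiM ?sumr_fset_gt0//; exact: tripnorm_block.
have powB (s : bool) (x : R) : `|s%:R * x| `^ q = s%:R * `|x| `^ q.
  by case: s; rewrite ?mul1r// !mul0r normr0 powR0// gt_eqF.
exists S; split.
  apply/mixnorm_le => // D D0; apply: exists_uniform => [i j|F].
    by rewrite mulr_ge0 ?powR_ge0 ?ltW.
  have [i iD hi] := S1 D F D0; exists i => //.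
  by under eq_bigr do rewrite powB.
apply/mixnorm_le => // D D0; apply: exists_uniform => [i j|F].
  by rewrite mulr_ge0 ?powR_ge0 ?ltW.
have [i iD hi] := S2 D F D0; exists i => //.
by under eq_bigr do rewrite powB.
Qed.

End upper_bound.

(** * The two inequalities for the K-functional *)

Theorem theorem2p7 (R : realType) (M N : choiceType)
  (mu : M -> R) (nu : N -> R) (p : \bar R) (q t : R)
  (hmu : forall i, 0 < mu i) (hnu : forall j, 0 < nu j)
  (ht : 0 < t) (hq : 1 <= q) (hqp : (q%:E < p)%E)
  (a : M -> N -> R) :
  ((Cpq p q)%:E * tripnorm mu nu p q t a <= Kfun mu nu p q t a)%E /\
  (Kfun mu nu p q t a <= 2%:E * tripnorm mu nu p q t a)%E.
Proof.
have hp : (0 < p)%E.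
  by apply: lt_trans hqp; rewrite lte_fin; exact: lt_le_trans hq.
split.
  apply: le_ereal_inf_tmp => _ [[b c] /= abc <-].
  have -> : a = fun i j => b i j + c i j.
    by apply/funext => i; apply/funext => j; exact: abc.
  have : (0 <= mixnorm mu nu p q b)%E by exact: weaknorm_ge0.
  have : (0 <= mixnormT mu nu p q c)%E by exact: weaknorm_ge0.
  case cE : (mixnormT mu nu p q c) => [C| |//]; last first.
    move=> _ b0; rewrite gt0_muley ?lte_fin// addey ?leey//.
    by rewrite gt_eqF// (lt_le_trans _ b0).
  case bE : (mixnorm mu nu p q b) => [B| |//]; last by rewrite addye ?leey.
  rewrite !lee_fin => C0 B0; apply/lee_addgt0Pr => e e0.
  have K0 := Cpq_gt0 p q hq hqp.
  (* Enlarging by e/2 and e/(2t) makes both bounds positive and costs exactly [e] in the weighted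
     sum. *)
  have Be : 0 < B + e / 2 by rewrite ltr_wpDl// divr_gt0.
  have Ce : 0 < C + e / 2 / t by rewrite ltr_wpDl// !divr_gt0.
  have h : (tripnorm mu nu p q t (fun i j => (b i j + c i j)%R) <=
      ((B + e / 2 + t * (C + e / 2 / t)) / Cpq p q)%:E)%E.
    apply: tripnorm_le => //.
      by rewrite bE lee_fin lerDl divr_ge0// ltW.
    by rewrite cE lee_fin lerDl !divr_ge0// ltW.
  have K0' : (0 <= (Cpq p q)%:E)%E by rewrite lee_fin ltW.
  apply: le_trans (lee_wpmul2l K0' h) _.
  rewrite -!EFinM -!EFinD lee_fin mulrC divfK ?gt_eqF//.
  rewrite le_eqVlt; apply/orP; left; apply/eqP; field; exact: lt0r_neq0.
have : (0 <= tripnorm mu nu p q t a)%E by apply: ereal_sup_ubound; left.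
case aE : (tripnorm mu nu p q t a) => [A| |//]; last first.
  by rewrite gt0_muley ?leey// lte_fin.
rewrite lee_fin => A0.
have [|S [bA cA]] := exists_splitting _ _ mu nu p q t A a hmu hnu ht hq hqp A0.
  by rewrite aE.
apply: le_trans.
  apply: ereal_inf_lbound; exists
    (fun i j => (S i j)%:R * a i j, fun i j => (~~ S i j)%:R * a i j) => //=.
  by move=> i j; case: (S i j); rewrite !(mul1r, mul0r) ?addr0 ?add0r.
have t0 : (0 <= t%:E)%E by rewrite lee_fin ltW.
(* The constant 2 arises here, as A + t (A/t) = 2 A. *)
apply: le_trans (leeD bA (lee_wpmul2l t0 cA)) _.
rewrite -!EFinM -EFinD lee_fin le_eqVlt; apply/orP; left; apply/eqP.
by field; exact: lt0r_neq0.
Qed.
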